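(* Let $1\le r\le n$ be integers and let $(I,J,K)\in\widetilde T^n_r$. (i) If $r=1$, then $(I,J,K)$ is irreducible if and only if $n=1$ and $(I,J,K)=(\{1\},\{1\},\{1\})$. (ii) If $r=2$, then $(I,J,K)$ is irreducible if and only if $n=2$ and $(I,J,K)=(\{1,2\},\{1,2\},\{1,2\})$. (iii) If $r=3$, then $(I,J,K)$ is irreducible if and only if $$(I,J,K)=(\{m,m+\ell,n\},\{m,m+\ell,n\},\{m,m+\ell,n\})$$ for some integers $\ell$ and $m$ satisfying $1\le\ell\le m$ and $2m+\ell=n$.
   Context: Subsets of $\{1,\dots,n\}$ are indexed increasingly: $I=\{i_1<\cdots<i_r\}$, and likewise $J=\{j_1<\cdots<j_r\}$, $K=\{k_1<\cdots<k_r\}$; also set $i_0=j_0=k_0=0$. Horn sets. For $1\le r\le n$, let $U^n_r$ be the set of triples $(I,J,K)$ of subsets of $\{1,\dots,n\}$ of cardinality $r$ with $\sum_{i\in I}i+\sum_{j\in J}j=\sum_{k\in K}k+\frac{r(r+1)}2$. Put $T^n_1=U^n_1$ and, for $r\ge2$, recursively let $T^n_r$ be the set of $(I,J,K)\in U^n_r$ such that $\sum_{f\in F}i_f+\sum_{g\in G}j_g\le\sum_{h\in H}k_h+\frac{p(p+1)}2$ for all $1\le p<r$ and all $(F,G,H)\in T^r_p$. Let $\sigma_n(i)=n+1-i$ on $\{1,\dots,n\}$ and $\widetilde T^n_r=\{(\sigma_n(I),\sigma_n(J),K)\mid (I,J,K)\in T^n_r\}$. A triple $(I,J,K)\in\widetilde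 T^n_r$ is (TT-)reducible if there are $u,v,w\in\{0,\dots,r\}$ with $u+v+w=r$ such that: $u=r$ or $i_{u+1}-i_u\ge2$; $v=r$ or $j_{v+1}-j_v\ge2$; $w=r$ or $k_{w+1}-k_w\ge2$; and $i_u+j_v+k_w\le n-1$. Otherwise it is (TT-)irreducible. *)

(* Defs.v *)
From mathcomp Require Import all_boot finmap.

Set Implicit Arguments.
Unset Strict Implicit.
Unset Printing Implicit Defensive.

Local Open Scope fset_scope.
Local Open Scope nat_scope.

(* {1, ..., n} *)
Definition interval1 (n : nat) : {fset nat} := [fset i in iota 1 n].

(* elt I a is i_a, where I = {i_1 < ... < i_r} and i_0 = 0; it is only
   meaningful for 0 <= a <= r. *)
Definition elt (I : {fset nat}) (a : nat) : nat := nth 0 (0 :: sort leq I) a.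

Definition rsubset (n r : nat) (I : {fset nat}) : Prop :=
  I `<=` interval1 n /\ #|` I| = r.

Definition hornU (n r : nat) (I J K : {fset nat}) : Prop :=
  [/\ rsubset n r I, rsubset n r J, rsubset n r K &
      \sum_(i <- I) i + \sum_(j <- J) j
        = \sum_(k <- K) k + (r * r.+1)./2].

(* T^n_r is defined from T^r_p for all p < r.  The parameter d only bounds the
   depth of this recursion; depth r suffices, see hornT_eq. *)
Fixpoint hornT_rec (d n r : nat) (I J K : {fset nat}) : Prop :=
  hornU n r I J K /\
  (if d is d'.+1 then
     forall (p : nat) (F G H : {fset nat}), 1 <= p < r ->
       hornT_rec d' r p F G H ->
       \sum_(f <- F) elt I f + \sum_(g <- G) elt J g
         <= \sum_(h <- H) elt K h + (p * p.+1)./2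
   else True).

Definition hornT (n r : nat) (I J K : {fset nat}) : Prop :=
  hornT_rec r n r I J K.

Lemma hornT_rec_depth (d n r : nat) (I J K : {fset nat}) :
  r <= d -> hornT_rec d n r I J K <-> hornT n r I J K.
Proof.
move=> le_rd.
suff H d1 d2 : forall m s A B C, s <= d1 -> s <= d2 ->
    hornT_rec d1 m s A B C <-> hornT_rec d2 m s A B C by exact: H.
elim: d1 d2 => [|d1 IH] [|d2] m [|s] A B C //= le1 le2;
  try by split=> [] [HU _]; split=> // p F G H; rewrite ltn0 andbF.
split=> [] [HU HT]; split=> // p F G H lt_p HF; apply: (HT p _ _ _ lt_p);
  have /andP[_ le_ps] := lt_p;
  have [le_p1 le_p2] := (leq_trans le_ps le1, leq_trans le_ps le2).
- exact: (proj2 (IH d2 _ _ _ _ _ le_p1 le_p2)).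
- exact: (proj1 (IH d2 _ _ _ _ _ le_p1 le_p2)).
Qed.

Lemma hornT_eq (n r : nat) (I J K : {fset nat}) :
  hornT n r I J K <->
  (hornU n r I J K /\
   forall (p : nat) (F G H : {fset nat}), 1 <= p < r ->
     hornT r p F G H ->
     \sum_(f <- F) elt I f + \sum_(g <- G) elt J g
       <= \sum_(h <- H) elt K h + (p * p.+1)./2).
Proof.
rewrite /hornT; case: r => [|r] /=.
  by split=> [] [HU _]; split=> // p F G H; rewrite ltn0 andbF.
split=> [] [HU HT]; split=> // p F G H lt_p HF; apply: (HT p _ _ _ lt_p);
  have /andP[_ le_pr] := lt_p.
- exact: (proj2 (@hornT_rec_depth r r.+1 p F G H le_pr)).
- exact: (proj1 (@hornT_rec_depth r r.+1 p F G H le_pr)).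
Qed.

Definition sigma (n : nat) (I : {fset nat}) : {fset nat} :=
  [fset n + 1 - i | i in I].

Definition hornTt (n r : nat) (I J K : {fset nat}) : Prop :=
  exists I' J' : {fset nat},
    [/\ hornT n r I' J' K, I = sigma n I' & J = sigma n J'].

Definition has_gap (r : nat) (I : {fset nat}) (u : nat) : Prop :=
  u = r \/ 2 <= elt I u.+1 - elt I u.

Definition reducible (n r : nat) (I J K : {fset nat}) : Prop :=
  exists u v w : nat,
    [/\ u + v + w = r,
        has_gap r I u, has_gap r J v, has_gap r K w &
        elt I u + elt J v + elt K w <= n - 1].

Definition irreducible (n r : nat) (I J K : {fset nat}) : Prop :=
  ~ reducible n r I J K.

(* Main.v *)
(* For r = 3 write a triple of T~ as i, j, k; then all entries sum to 6n, and
   the Horn inequalities read i_a + j_b + k_c > 2n when a + b + c = 7 and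
   i_a + j_b + k_c < 2n when a + b + c = 5.  Irreducibility at (3,0,0) and its
   permutations forces i_3 = j_3 = k_3 = n, as an entry 1 in one of the sets
   makes the other two contain n.  At (2,1,0) and its permutations it then
   forces i_2 + j_1 >= n and so on; since these six sums add up to 6n, they
   are all equal to n, hence the three sets coincide.  Finally (1,1,1) gives
   i_2 <= 2 i_1. *)
Require Import Defs.
From mathcomp Require Import all_boot finmap zify.

Set Implicit Arguments.
Unset Strict Implicit.

Local Open Scope fset_scope.
Local Open Scope nat_scope.

(** * Finite sets of integers as strictly increasing lists *)

Lemma sort_fset_seq (s : seq nat) : sorted ltn s -> sort leq [fset x in s] = s.
Proof.
move=> s_lt; apply: (sorted_eq leq_trans anti_leq).
- exact: sort_sorted leq_total _.
- exact: sub_sorted ltnW _ s_lt.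
rewrite perm_sort uniq_perm ?fset_uniq ?(sorted_uniq ltn_trans ltnn) //.
by move=> x; rewrite inE.
Qed.

Lemma elt_fset_seq (s : seq nat) (a : nat) :
  sorted ltn s -> elt [fset x in s] a = nth 0 (0 :: s) a.
Proof. by rewrite /elt => /sort_fset_seq->. Qed.

Lemma sum_fset_seq (s : seq nat) (F : nat -> nat) :
  uniq s -> \sum_(x <- [fset x in s]) F x = \sum_(x <- s) F x.
Proof.
move=> s_uniq; apply: perm_big; apply: uniq_perm => // x.
by rewrite inE.
Qed.

(** Reflection reverses the order of entries up to [n]; the [rev] makes the list increasing again,
    so that entries can be read off it. *)
Lemma sigma_fset_seq (n : nat) (s : seq nat) :
  sigma n [fset x in s] = [fset x in rev [seq n + 1 - x | x <- s]].
Proof.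
apply/fsetP=> x; have -> : (x \in [fset x in rev [seq n + 1 - x | x <- s]])
  = (x \in [seq n + 1 - x | x <- s]) by rewrite inE /= mem_rev.
apply/imfsetP/mapP => -[y].
  by rewrite inE => ys ->; exists y.
by move=> ys ->; exists y; rewrite ?inE.
Qed.

Lemma rsubset_seqP (n r : nat) (I : {fset nat}) :
  rsubset n r I <->
  exists s : seq nat,
    [/\ sorted ltn s, size s = r, all (fun x => 0 < x <= n) s
      & I = [fset x in s]].
Proof.
split=> [[/fsubsetP sIn <-]|[s [s_lt <- /allP s_le ->]]].
  exists (sort leq I); split.
  - rewrite ltn_sorted_uniq_leq sort_uniq fset_uniq.
    exact: sort_sorted leq_total _.
  - by rewrite size_sort.
  - by apply/allP=> x; rewrite mem_sort => /sIn; rewrite inE mem_iota /=; lia.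
  - by apply/fsetP=> x; rewrite inE mem_sort.
split; last by rewrite -[RHS](congr1 size (sort_fset_seq s_lt)) size_sort.
by apply/fsubsetP=> x; rewrite inE => /s_le; rewrite inE mem_iota /=; lia.
Qed.

Lemma fset_seq1 (a : nat) : [fset x in [:: a]] = [fset a].
Proof. by apply/fsetP=> x; rewrite !inE /= orbF. Qed.

Lemma fset_seq2 (a b : nat) : [fset x in [:: a; b]] = [fset a; b].
Proof. by apply/fsetP=> x; rewrite !inE /= orbF. Qed.

Lemma fset_seq3 (a b c : nat) : [fset x in [:: a; b; c]] = [fset a; b; c].
Proof. by apply/fsetP=> x; rewrite !inE /= orbF orbA. Qed.

Lemma rsubset1P (n : nat) (I : {fset nat}) :
  rsubset n 1 I <-> exists2 a, 0 < a <= n & I = [fset x in [:: a]].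
Proof.
rewrite rsubset_seqP; split=> [|[a ha ->]].
  by move=> [[|a [|? ?]] [//= _ _ /andP[ha _] ->]]; exists a.
by exists [:: a]; rewrite /= ha.
Qed.

Lemma rsubset2P (n : nat) (I : {fset nat}) :
  rsubset n 2 I <->
  exists a b, [/\ 0 < a, a < b, b <= n & I = [fset x in [:: a; b]]].
Proof.
rewrite rsubset_seqP; split.
  move=> [[|a [|b [|? ?]]] [//= lt_s _ le_s ->]].
  by exists a, b; split=> //; lia.
move=> [a [b [a0 ab bn ->]]]; exists [:: a; b]; split=> //=; lia.
Qed.

Lemma rsubset3P (n : nat) (I : {fset nat}) :
  rsubset n 3 I <->
  exists a b c, [/\ 0 < a, a < b, b < c, c <= n & I = [fset x in [:: a; b; c]]].
Proof.
rewrite rsubset_seqP; split.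
  move=> [[|a [|b [|c [|? ?]]]] [//= lt_s _ le_s ->]].
  by exists a, b, c; split=> //; lia.
move=> [a [b [c [a0 ab bc cn ->]]]]; exists [:: a; b; c]; split=> //=; lia.
Qed.

(** * Horn triples with [r = 1] and [r = 2] *)

Lemma hornT_inequality (n r p : nat) (I J K F G H : {fset nat}) :
  hornT n r I J K -> 0 < p < r -> hornT r p F G H ->
  \sum_(f <- F) elt I f + \sum_(g <- G) elt J g
    <= \sum_(h <- H) elt K h + (p * p.+1)./2.
Proof. by move=> /hornT_eq[_ ineq] ltpr; apply: ineq. Qed.

(** No [p] satisfies [1 <= p < 1], so only the sum condition remains. It gives [a, b <= c], whence
    the single upper bound [c <= n]. *)
Lemma hornT1P (n : nat) (I J K : {fset nat}) :
  hornT n 1 I J K <->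
  exists a b c, [/\ 0 < a, 0 < b, c <= n, a + b = c.+1 &
    (I, J, K) = ([fset x in [:: a]], [fset x in [:: b]], [fset x in [:: c]])].
Proof.
rewrite hornT_eq /hornU; split.
  move=> [[/rsubset1P[a ha ->] /rsubset1P[b hb ->] /rsubset1P[c hc ->]] + _].
  rewrite !sum_fset_seq // !big_seq1 => sum_abc.
  by exists a, b, c; split=> //; lia.
move=> [a [b [c [a0 b0 cn abc [-> -> ->]]]]]; split; last by case.
split; try (apply/rsubset1P; eexists; last by []; lia).
by rewrite !sum_fset_seq // !big_seq1; lia.
Qed.

(** The last hypotheses are the inequalities for (1,1,1), (1,2,2) and (2,1,2), which make up all of
    T^2_1. Applied inside {1, 2, 3}, the lemma supplies index triples for the [p = 2] inequalities
    at [r = 3]. *)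
Lemma hornT2 (n i1 i2 j1 j2 k1 k2 : nat) :
  [/\ 0 < i1 < i2, 0 < j1 < j2 & 0 < k1 < k2] ->
  [/\ i2 <= n, j2 <= n & k2 <= n] ->
  i1 + i2 + (j1 + j2) = k1 + k2 + 3 ->
  [/\ i1 + j1 <= k1.+1, i1 + j2 <= k2.+1 & i2 + j1 <= k2.+1] ->
  hornT n 2 [fset x in [:: i1; i2]] [fset x in [:: j1; j2]]
    [fset x in [:: k1; k2]].
Proof.
move=> [hi hj hk] [i2n j2n k2n] sum2 [h111 h122 h212]; apply/hornT_eq; split.
  split; try (apply/rsubset2P; do 2 eexists; split; last by []; lia).
  rewrite !sum_fset_seq; try (rewrite /= inE; lia).
  by rewrite !big_cons !big_nil /=; lia.
move=> [//|[|p]] F G H; last by lia.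
move=> _ /hornT1P[a [b [c [a0 b0 c2 abc [-> -> ->]]]]].
rewrite !sum_fset_seq // !big_seq1 !elt_fset_seq; try (rewrite /=; lia).
have : a = 1 /\ b = 1 /\ c = 1 \/ a = 1 /\ b = 2 /\ c = 2
    \/ a = 2 /\ b = 1 /\ c = 2 by lia.
by case=> [|[|]] -[-> [-> ->]] /=; lia.
Qed.

(** * Entries and sums of sets with at most three elements *)

Lemma elt1E (a : nat) : elt [fset x in [:: a]] =1 nth 0 [:: 0; a].
Proof. by move=> x; rewrite elt_fset_seq. Qed.

Lemma elt2E (a b : nat) :
  a < b -> elt [fset x in [:: a; b]] =1 nth 0 [:: 0; a; b].
Proof. by move=> ab x; rewrite elt_fset_seq //= ab. Qed.

Lemma elt3E (a b c : nat) :
  a < b -> b < c -> elt [fset x in [:: a; b; c]] =1 nth 0 [:: 0; a; b; c].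
Proof. by move=> ab bc x; rewrite elt_fset_seq //= ab bc. Qed.

Lemma sum1E (a : nat) (F : nat -> nat) :
  \sum_(x <- [fset x in [:: a]]) F x = F a.
Proof. by rewrite sum_fset_seq // big_seq1. Qed.

Lemma sum2E (a b : nat) (F : nat -> nat) :
  a < b -> \sum_(x <- [fset x in [:: a; b]]) F x = F a + F b.
Proof.
move=> ab; rewrite sum_fset_seq; last by rewrite /= inE; lia.
by rewrite !big_cons big_nil addn0.
Qed.

Lemma sum3E (a b c : nat) (F : nat -> nat) :
  a < b -> b < c ->
  \sum_(x <- [fset x in [:: a; b; c]]) F x = F a + F b + F c.
Proof.
move=> ab bc; rewrite sum_fset_seq; last by rewrite /= !inE; lia.
by rewrite !big_cons big_nil addn0 addnA.
Qed.

(** * Numerical constraints on T~ for [r = 1, 2, 3] *)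

Lemma hornTt1 (n : nat) (I J K : {fset nat}) :
  hornTt n 1 I J K ->
  exists i j k, [/\ 0 < i <= n, 0 < j <= n, 0 < k <= n, i + j + k = 2 * n + 1 &
    (I, J, K) = ([fset x in [:: i]], [fset x in [:: j]], [fset x in [:: k]])].
Proof.
move=> [I' [J' [/hornT1P[a [b [c [a0 b0 cn abc [-> -> ->]]]]] -> ->]]].
exists (n + 1 - a), (n + 1 - b), c.
by rewrite !sigma_fset_seq; split=> //; lia.
Qed.

(** As [sigma] sends index f to 3 - f, the inequality a_f + b_g <= c_h + 1 becomes i_(3-f) + j_(3-g)
    + k_h > 2n, and the sum condition gives the total 4(n + 1) - 3. *)
Lemma hornTt2 (n : nat) (I J K : {fset nat}) :
  hornTt n 2 I J K ->
  exists i1 i2 j1 j2 k1 k2,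
    [/\ [/\ 0 < i1 < i2, 0 < j1 < j2 & 0 < k1 < k2],
        [/\ i2 <= n, j2 <= n & k2 <= n],
        i1 + i2 + (j1 + j2) + (k1 + k2) = 4 * n + 1,
        [/\ 2 * n < i1 + j2 + k2, 2 * n < i2 + j1 + k2 & 2 * n < i2 + j2 + k1] &
        (I, J, K) = ([fset x in [:: i1; i2]], [fset x in [:: j1; j2]],
                     [fset x in [:: k1; k2]])].
Proof.
move=> [I' [J' [T -> ->]]].
have [[+ + + +] _] := proj1 (hornT_eq _ _ _ _ _) T.
move=> /rsubset2P[a1 [a2 [a1_gt a12 a2n EI]]].
move=> /rsubset2P[b1 [b2 [b1_gt b12 b2n EJ]]].
move=> /rsubset2P[c1 [c2 [c1_gt c12 c2n EK]]].
rewrite {}EI {}EJ {}EK in T *; rewrite !sum2E // => sumE.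
have ineq (f g h : nat) : 0 < f -> 0 < g -> h <= 2 -> f + g = h.+1 ->
    nth 0 [:: 0; a1; a2] f + nth 0 [:: 0; b1; b2] g
      <= nth 0 [:: 0; c1; c2] h + 1.
  move=> f0 g0 h2 fgh.
  have := hornT_inequality (p := 1) (F := [fset x in [:: f]])
    (G := [fset x in [:: g]]) (H := [fset x in [:: h]]) T isT.
  rewrite !sum1E !elt2E //; apply; apply/hornT1P.
  by exists f, g, h.
have /= ineq111 := ineq 1 1 1 isT isT isT erefl.
have /= ineq122 := ineq 1 2 2 isT isT isT erefl.
have /= ineq212 := ineq 2 1 2 isT isT isT erefl.
exists (n + 1 - a2), (n + 1 - a1), (n + 1 - b2), (n + 1 - b1), c1, c2.
rewrite !sigma_fset_seq /rev /=.
by clear ineq T; split=> //; first [lia | split; lia].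
Qed.

(** Reversal now sends index f to 4 - f. A [p = 2] inequality says that six entries sum to at least
    4n + 1; subtracted from the total 6n, it bounds the other three strictly below 2n. *)
Lemma hornTt3 (n : nat) (I J K : {fset nat}) :
  hornTt n 3 I J K ->
  exists i1 i2 i3 j1 j2 j3 k1 k2 k3,
    [/\ [/\ 0 < i1 < i2, i2 < i3 <= n, 0 < j1 < j2 & j2 < j3 <= n] /\
          (0 < k1 < k2 /\ k2 < k3 <= n),
        i1 + i2 + i3 + (j1 + j2 + j3) + (k1 + k2 + k3) = 6 * n,
        [/\ 2 * n < i1 + j3 + k3, 2 * n < i3 + j1 + k3
          & 2 * n < i3 + j3 + k1] /\
        [/\ 2 * n < i3 + j2 + k2, 2 * n < i2 + j3 + k2
          & 2 * n < i2 + j2 + k3],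
        [/\ i1 + j2 + k2 < 2 * n, i2 + j1 + k2 < 2 * n & i2 + j2 + k1 < 2 * n] &
        (I, J, K) = ([fset x in [:: i1; i2; i3]], [fset x in [:: j1; j2; j3]],
                     [fset x in [:: k1; k2; k3]])].
Proof.
move=> [I' [J' [T -> ->]]].
have [[+ + + +] _] := proj1 (hornT_eq _ _ _ _ _) T.
move=> /rsubset3P[a1 [a2 [a3 [a1_gt a12 a23 a3n EI]]]].
move=> /rsubset3P[b1 [b2 [b3 [b1_gt b12 b23 b3n EJ]]]].
move=> /rsubset3P[c1 [c2 [c3 [c1_gt c12 c23 c3n EK]]]].
rewrite {}EI {}EJ {}EK in T *; rewrite !sum3E // => sumE.
have ineq1 (f g h : nat) : 0 < f -> 0 < g -> h <= 3 -> f + g = h.+1 ->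
    nth 0 [:: 0; a1; a2; a3] f + nth 0 [:: 0; b1; b2; b3] g
      <= nth 0 [:: 0; c1; c2; c3] h + 1.
  move=> f0 g0 h2 fgh.
  have := hornT_inequality (p := 1) (F := [fset x in [:: f]])
    (G := [fset x in [:: g]]) (H := [fset x in [:: h]]) T isT.
  rewrite !sum1E !elt3E //; apply; apply/hornT1P.
  by exists f, g, h.
have ineq2 (f1 f2 g1 g2 h1 h2 : nat) :
    [/\ 0 < f1 < f2, 0 < g1 < g2 & 0 < h1 < h2] ->
    [/\ f2 <= 3, g2 <= 3 & h2 <= 3] ->
    f1 + f2 + (g1 + g2) = h1 + h2 + 3 ->
    [/\ f1 + g1 <= h1.+1, f1 + g2 <= h2.+1 & f2 + g1 <= h2.+1] ->
    nth 0 [:: 0; a1; a2; a3] f1 + nth 0 [:: 0; a1; a2; a3] f2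
        + (nth 0 [:: 0; b1; b2; b3] g1 + nth 0 [:: 0; b1; b2; b3] g2)
      <= nth 0 [:: 0; c1; c2; c3] h1 + nth 0 [:: 0; c1; c2; c3] h2 + 3.
  move=> lt12 le3 sum2 h2_ineq.
  have := hornT_inequality (p := 2) T isT (hornT2 lt12 le3 sum2 h2_ineq).
  have [/andP[_ f12] /andP[_ g12] /andP[_ h12]] := lt12.
  by rewrite !sum2E // !elt3E.
(* These six are all the positive solutions of f + g = h + 1 with h <= 3, that is, T^3_1. *)
have /= ineq111 := ineq1 1 1 1 isT isT isT erefl.
have /= ineq122 := ineq1 1 2 2 isT isT isT erefl.
have /= ineq133 := ineq1 1 3 3 isT isT isT erefl.
have /= ineq212 := ineq1 2 1 2 isT isT isT erefl.
have /= ineq223 := ineq1 2 2 3 isT isT isT erefl.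
have /= ineq313 := ineq1 3 1 3 isT isT isT erefl.
(* After reversal, the pairs {1,2} and {1,3} in F or G leave out the first and second entry; {1,3}
   and {2,3} in H leave out k_2 and k_1. The complements are i_1 + j_2 + k_2, i_2 + j_1 + k_2 and
   i_2 + j_2 + k_1, in this order. *)
have /= ineq12_13_13 := ineq2 1 2 1 3 1 3
  ltac:(by []) ltac:(by []) erefl ltac:(by []).
have /= ineq13_12_13 := ineq2 1 3 1 2 1 3
  ltac:(by []) ltac:(by []) erefl ltac:(by []).
have /= ineq13_13_23 := ineq2 1 3 1 3 2 3
  ltac:(by []) ltac:(by []) erefl ltac:(by []).
exists (n + 1 - a3), (n + 1 - a2), (n + 1 - a1),
  (n + 1 - b3), (n + 1 - b2), (n + 1 - b1), c1, c2, c3.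
rewrite !sigma_fset_seq /rev /=.
clear ineq1 ineq2 T; rewrite /= in sumE.
by split=> //; repeat split; lia.
Qed.

(** * Arithmetic consequences of irreducibility *)

Lemma irreducible_ge (n r : nat) (I J K : {fset nat}) (u v w : nat) :
  0 < n -> irreducible n r I J K -> u + v + w = r ->
  has_gap r I u -> has_gap r J v -> has_gap r K w ->
  n <= elt I u + elt J v + elt K w.
Proof.
move=> n0 irr uvw gI gJ gK; rewrite leqNgt; apply/negP => lt_n.
by apply: irr; exists u, v, w; split=> //; lia.
Qed.

(** The implications are irreducibility at the splittings (u, v, w) of 3, with gap conditions as
    antecedents: a gap at 0 reads [1 < i1] because i_0 = 0, and a gap at 3 is automatic. *)
Lemma irreducible3_arith (n i1 i2 i3 j1 j2 j3 k1 k2 k3 : nat) :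
  [/\ 0 < i1 < i2, i2 < i3 <= n, 0 < j1 < j2 & j2 < j3 <= n] ->
  0 < k1 < k2 -> k2 < k3 <= n ->
  i1 + i2 + i3 + (j1 + j2 + j3) + (k1 + k2 + k3) = 6 * n ->
  [/\ 2 * n < i1 + j3 + k3, 2 * n < i3 + j1 + k3 & 2 * n < i3 + j3 + k1] ->
  [/\ 2 * n < i3 + j2 + k2, 2 * n < i2 + j3 + k2 & 2 * n < i2 + j2 + k3] ->
  [/\ i1 + j2 + k2 < 2 * n, i2 + j1 + k2 < 2 * n & i2 + j2 + k1 < 2 * n] ->
  [/\ 1 < j1 -> 1 < k1 -> n <= i3, 1 < i1 -> 1 < k1 -> n <= j3
    & 1 < i1 -> 1 < j1 -> n <= k3] ->
  (i1 + 1 < i2 -> j1 + 1 < j2 -> k1 + 1 < k2 -> n <= i1 + j1 + k1) ->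
  [/\ (i2 + 1 < i3 -> j1 + 1 < j2 -> 1 < k1 -> n <= i2 + j1),
      (i2 + 1 < i3 -> k1 + 1 < k2 -> 1 < j1 -> n <= i2 + k1)
    & (j2 + 1 < j3 -> i1 + 1 < i2 -> 1 < k1 -> n <= i1 + j2)] ->
  [/\ (j2 + 1 < j3 -> k1 + 1 < k2 -> 1 < i1 -> n <= j2 + k1),
      (k2 + 1 < k3 -> i1 + 1 < i2 -> 1 < j1 -> n <= i1 + k2)
    & (k2 + 1 < k3 -> j1 + 1 < j2 -> 1 < i1 -> n <= j1 + k2)] ->
  [/\ j1 = i1, k1 = i1, j2 = i2 & k2 = i2] /\
  [/\ i3 = n, j3 = n, k3 = n, i1 + i2 = n & i2 <= 2 * i1].
Proof.
move=> [hi1 hi2 hj1 hj2] hk1 hk2 hs [a1 a2 a3] [b1 b2 b3] [d1 d2 d3].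
move=> [e1 e2 e3] f [g1 g2 g3] [h1 h2 h3].
have ei : i3 = n by clear -hi1 hi2 hj1 hj2 hk1 hk2 a1 a2 a3 e1; lia.
have ej : j3 = n by clear -hi1 hi2 hj1 hj2 hk1 hk2 a1 a2 a3 e2; lia.
have ek : k3 = n by clear -hi1 hi2 hj1 hj2 hk1 hk2 a1 a2 a3 e3; lia.
subst i3 j3 k3; clear a1 a2 a3 e1 e2 e3.

(* If i2 + j1 < n, the sum condition and i1 + j2 + k2 < 2n give k1 > 1; the
   other gaps come from i2 + j2 > n and j1 > 0, so (2, 1, 0) is a reduction. *)
have p1 : n <= i2 + j1 by clear g2 g3 h1 h2 h3 f; lia.
have p2 : n <= i2 + k1 by clear g1 g3 h1 h2 h3 f; lia.
have p3 : n <= i1 + j2 by clear g1 g2 h1 h2 h3 f; lia.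
have p4 : n <= j2 + k1 by clear g1 g2 g3 h2 h3 f; lia.
have p5 : n <= i1 + k2 by clear g1 g2 g3 h1 h3 f; lia.
have p6 : n <= j1 + k2 by clear g1 g2 g3 h1 h2 f; lia.
clear g1 g2 g3 h1 h2 h3 b1 b2 b3 d1 d2 d3.
(* The first and second entries sum to 3n and each occurs twice in [p1] to [p6], so all six
   inequalities are equalities. *)
have [-> -> -> -> eS] : [/\ j1 = i1, k1 = i1, j2 = i2, k2 = i2 & i1 + i2 = n].
  clear f; split; lia.
(* If i2 = i1 + 1, then i2 <= 2 i1 because i1 >= 1; otherwise [f] gives n <= 3 i1, where n = i1 +
   i2. *)
by split; [|split=> //; lia].
Qed.

(** Again the largest entries equal n, so i1 + j1 + k1 = n + 1. If n > 2, some first entry, say k1,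
    is at least 2. Then i1 + j1 <= n - 1, which also forces gaps after i1 and j1, and (1,1,0) is a
    reduction. *)
Lemma irreducible2_arith (n i1 i2 j1 j2 k1 k2 : nat) :
  [/\ 0 < i1 < i2, 0 < j1 < j2 & 0 < k1 < k2] ->
  [/\ i2 <= n, j2 <= n & k2 <= n] ->
  i1 + i2 + (j1 + j2) + (k1 + k2) = 4 * n + 1 ->
  [/\ 2 * n < i1 + j2 + k2, 2 * n < i2 + j1 + k2 & 2 * n < i2 + j2 + k1] ->
  [/\ 1 < j1 -> 1 < k1 -> n <= i2, 1 < i1 -> 1 < k1 -> n <= j2
    & 1 < i1 -> 1 < j1 -> n <= k2] ->
  [/\ i1 + 1 < i2 -> j1 + 1 < j2 -> 1 < k1 -> n <= i1 + j1,
      i1 + 1 < i2 -> k1 + 1 < k2 -> 1 < j1 -> n <= i1 + k1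
    & j1 + 1 < j2 -> k1 + 1 < k2 -> 1 < i1 -> n <= j1 + k1] ->
  n = 2.
Proof.
move=> [i12 j12 k12] [i2n j2n k2n] sumE [h1 h2 h3] [e1 e2 e3] [f1 f2 f3].
have ei : i2 = n by clear f1 f2 f3 e2 e3; lia.
have ej : j2 = n by clear f1 f2 f3 e1 e3; lia.
have ek : k2 = n by clear f1 f2 f3 e1 e2; lia.
subst i2 j2 k2; lia.
Qed.

Theorem proposition3p15 (n r : nat) (I J K : {fset nat})
    (hr1 : 1 <= r) (hrn : r <= n) (hT : hornTt n r I J K) :
  [/\ r = 1 ->
        (irreducible n r I J K <->
         n = 1 /\ (I, J, K) = ([fset 1], [fset 1], [fset 1])),
      r = 2 ->
        (irreducible n r I J K <->
         n = 2 /\ (I, J, K) = ([fset 1; 2], [fset 1; 2], [fset 1; 2]))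
    & r = 3 ->
        (irreducible n r I J K <->
         exists l m : nat,
           [/\ 1 <= l, l <= m, 2 * m + l = n &
               (I, J, K) = ([fset m; m + l; n],
                            [fset m; m + l; n],
                            [fset m; m + l; n])])].
Proof.
have n0 : 0 < n by lia.
split=> rE; subst r.
- have [i [j [k [ib jb kb ijk [EI EJ EK]]]]] := hornTt1 hT; subst I J K.
  split=> [irr|[-> [-> -> ->]]]; last first.
    move=> [u [v [w [uvw]]]]; rewrite -fset_seq1 /has_gap !elt1E.
    by case: u v w uvw => [|[|u]] [|[|v]] [|[|w]] //= _; lia.
  have := irreducible_ge (u := 1) (v := 0) (w := 0) n0 irr erefl.
  have := irreducible_ge (u := 0) (v := 1) (w := 0) n0 irr erefl.
  have := irreducible_ge (u := 0) (v := 0) (w := 1) n0 irr erefl.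
  rewrite /has_gap !elt1E /= -!fset_seq1 => k_ge j_ge i_ge.
  (* Suppose n > 1. If all entries exceed 1, they all equal n, against the sum 2n + 1. If one entry
     is 1, the sum makes the other two n, and taking u, v or w = 1 at that entry is a reduction. *)
  have n1 : n = 1 by lia.
  have [-> -> ->] : [/\ i = 1, j = 1 & k = 1] by split; lia.
  by [].
- have [i1 [i2 [j1 [j2 [k1 [k2 [lt12 le2n sumE ineq [EI EJ EK]]]]]]]] :=
    hornTt2 hT; subst I J K.
  have [/andP[i1_gt i12] /andP[j1_gt j12] /andP[k1_gt k12]] := lt12.
  have [i2n j2n k2n] := le2n.
  split=> [irr|[-> [-> -> ->]]]; last first.
    move=> [u [v [w [uvw]]]]; rewrite -fset_seq2 /has_gap !elt2E //.
    by case: u v w uvw => [|[|[|u]]] [|[|[|v]]] [|[|[|w]]] //= _; lia.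
  have ge u v w := irreducible_ge (u := u) (v := v) (w := w) n0 irr.
  have := ge 2 0 0 erefl; have := ge 0 2 0 erefl; have := ge 0 0 2 erefl.
  have := ge 1 1 0 erefl; have := ge 1 0 1 erefl; have := ge 0 1 1 erefl.
  rewrite /has_gap !elt2E //=
    ?(add0n, addn0, subn0) => ge011 ge101 ge110 ge002 ge020 ge200.
  have n2 : n = 2.
    clear ge irr hT; apply: (irreducible2_arith lt12 le2n sumE ineq); split=> *.
    + by apply: ge200; lia.
    + by apply: ge020; lia.
    + by apply: ge002; lia.
    + by apply: ge110; lia.
    + by apply: ge101; lia.
    + by apply: ge011; lia.
  split=> //; clear -i1_gt i12 i2n j1_gt j12 j2n k1_gt k12 k2n n2.
  have [-> -> -> ->] : [/\ i1 = 1, i2 = 2, j1 = 1 & j2 = 2] by split; lia.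
  have [-> ->] : k1 = 1 /\ k2 = 2 by lia.
  by rewrite fset_seq2.
- have [i1 [i2 [i3 [j1 [j2 [j3 [k1 [k2 [k3 T3]]]]]]]]] := hornTt3 hT.
  have [bnd sumE [low7 low7'] up5 EIJK] := T3.
  have [[ltI leI ltJ leJ] [ltK leK]] := bnd.
  have [/andP[i1_gt i12] /andP[i23 i3n]] := (ltI, leI).
  have [/andP[j1_gt j12] /andP[j23 j3n]] := (ltJ, leJ).
  have [/andP[k1_gt k12] /andP[k23 k3n]] := (ltK, leK).
  split=> [irr|[l [m [l1 lm mln]]]]; last first.
    move=> [-> -> ->].
    have mml : m < m + l by lia.
    have mln' : m + l < n by lia.
    move=> [u [v [w [uvw]]]]; rewrite -fset_seq3 /has_gap !elt3E //.
    (* No splitting gives a sum below n: up to permutation, (3,0,0) gives n, (2,1,0) gives 2m + l =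
       n, and (1,1,1) gives 3m >= n since l <= m. *)
    by case: u v w uvw => [|[|[|[|u]]]] [|[|[|[|v]]]] [|[|[|[|w]]]] //= _; lia.
  case: EIJK irr => -> -> -> irr.
  have ge u v w := irreducible_ge (u := u) (v := v) (w := w) n0 irr.
  have := ge 3 0 0 erefl; have := ge 0 3 0 erefl; have := ge 0 0 3 erefl.
  rewrite /has_gap !elt3E //=
    ?(add0n, addn0, subn0) => ge003 ge030 ge300.
  have := ge 2 1 0 erefl; have := ge 2 0 1 erefl; have := ge 1 2 0 erefl.
  rewrite /has_gap !elt3E //=
    ?(add0n, addn0, subn0) => ge120 ge201 ge210.
  have := ge 0 2 1 erefl; have := ge 1 0 2 erefl; have := ge 0 1 2 erefl.
  have := ge 1 1 1 erefl.
  rewrite /has_gap !elt3E //=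
    ?(add0n, addn0, subn0) => ge111 ge012 ge102 ge021.
  have [||||[-> -> -> ->] [-> -> -> n_eq i2_le]] :=
    irreducible3_arith (And4 ltI leI ltJ leJ) ltK leK sumE low7 low7' up5.
  + by clear -ge300 ge030 ge003; split=> *;
       [apply: ge300 | apply: ge030 | apply: ge003]; lia.
  + by clear -ge111; move=> *; apply: ge111; lia.
  + by clear -ge210 ge201 ge120; split=> *;
       [apply: ge210 | apply: ge201 | apply: ge120]; lia.
  + by clear -ge021 ge102 ge012; split=> *;
       [apply: ge021 | apply: ge102 | apply: ge012]; lia.
  (* With m = i1 and l = i2 - i1, the bound l <= m is i2 <= 2 i1, and 2m + l = n is i1 + i2 = n. *)
  clear -i1_gt i12 n_eq i2_le; exists (i2 - i1), i1.
  have -> : i1 + (i2 - i1) = i2 by lia.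
  by rewrite fset_seq3; split=> //; lia.
Qed.
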